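(* For every integer $n\ge 4$, the wheel graph $W_n$ is not an MPF graph.
   Context: The wheel graph $W_n$ is the graph on $n$ vertices formed by connecting a single universal vertex to all vertices of a cycle $C_{n-1}$. All graphs are finite. A simple graph is an undirected graph without loops or multiple edges. A labeling of a graph on $n$ vertices is a bijection from its vertex set to $\{1,\ldots,n\}$; it determines the adjacency matrix $A(\cdot)$. A simple graph $X$ on $n$ vertices is an MPF (matrix product factorizable) graph if there exist simple graphs $G$ and $H$ on $n$ vertices and labelings of $G$, $H$ and $X$ such that, with respect to these labelings, $A(G)A(H)=A(X)$. *)

(* Defs.v *)
From mathcomp Require Import all_boot all_order all_algebra.

Set Implicit Arguments.
Unset Strict Implicit.
Unset Printing Implicit Defensive.

Import GRing.Theory.
Local Open Scope ring_scope.

Record sgraph (V : finType) := SGraph {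
  adj :> rel V;
  adj_sym : symmetric adj;
  adj_irr : irreflexive adj }.

(* Labels range over 'I_n = {0, ..., n-1} instead of {1, ..., n}.  The inverse
   bijection is a field because adjacency-matrix entries are read through it. *)
Record labeling (n : nat) (V : finType) := Labeling {
  label :> V -> 'I_n;
  vertex : 'I_n -> V;
  labelK : cancel label vertex;
  vertexK : cancel vertex label }.

Definition adjmx (n : nat) (V : finType) (G : sgraph V) (l : labeling n V)
  : 'M[int]_n :=
  \matrix_(i, j) (adj G (vertex l i) (vertex l j))%:R.

(* G and H have #|V| vertices because they carry labelings by 'I_#|V|; their
   vertex sets are otherwise unrelated to V. *)
Definition MPF (V : finType) (X : sgraph V) : Prop :=
  exists (U W : finType) (G : sgraph U) (H : sgraph W)
         (lG : labeling #|V| U) (lH : labeling #|V| W) (lX : labeling #|V| V),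
    adjmx G lG *m adjmx H lH = adjmx X lX.

(* ordS i is i + 1 mod m.  The conjunct i != j only matters for m = 1; for
   m >= 3 this is the usual cycle. *)
Definition cycle_rel (m : nat) : rel 'I_m :=
  fun i j => (i != j) && ((j == ordS i) || (i == ordS j)).

Lemma cycle_rel_sym m : symmetric (@cycle_rel m).
Proof. by move=> i j; rewrite /cycle_rel eq_sym orbC. Qed.

Lemma cycle_rel_irr m : irreflexive (@cycle_rel m).
Proof. by move=> i; rewrite /cycle_rel eqxx. Qed.

Definition cycle_graph (m : nat) : sgraph 'I_m :=
  SGraph (@cycle_rel_sym m) (@cycle_rel_irr m).

(* None is the added universal vertex. *)
Definition cone_rel (V : finType) (G : sgraph V) : rel (option V) :=
  fun x y => match x, y with
             | Some u, Some v => adj G u v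
             | None, None => false
             | _, _ => true
             end.

Lemma cone_rel_sym (V : finType) (G : sgraph V) : symmetric (cone_rel G).
Proof. by case=> [u|] [v|] //=; apply: adj_sym. Qed.

Lemma cone_rel_irr (V : finType) (G : sgraph V) : irreflexive (cone_rel G).
Proof. by case=> [u|] //=; apply: adj_irr. Qed.

Definition cone (V : finType) (G : sgraph V) : sgraph (option V) :=
  SGraph (cone_rel_sym G) (cone_rel_irr G).

Definition wheel (n : nat) : sgraph (option 'I_n.-1) := cone (cycle_graph n.-1).

Lemma card_wheel (n : nat) : (0 < n)%N -> #|{: option 'I_n.-1}| = n.
Proof. by move=> n_gt0; rewrite card_option card_ord prednK. Qed.

(* Main.v *)
Require Import Defs.
From mathcomp Require Import all_boot all_order all_algebra.
From mathcomp Require Import zify.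

(** Read [A(G) A(H) = A(X)] on one common vertex set: [N_G(i)] and [N_H(j)] meet
    in exactly one vertex when [ij] is an edge of [X], and are disjoint
    otherwise.  Thus walks made of a [G]-edge followed by an [H]-edge are
    determined by their endpoints, which are adjacent in [X].  As [X] is
    undirected, such a walk from [i] to [j] exists if and only if one exists
    from [j] to [i]; so a [G]-edge [vu] and an [H]-edge [vw] always complete to
    a square [v u z w] with alternating edges.  Sliding along the squares shows
    that [H]-degrees are constant along [G]-edges ([deg_factor_edge]), and
    counting walks from [v] then gives
    [deg_X(v) = deg_G(v) deg_H(v)] ([deg_factorization]).

    Let [X] be a wheel with hub [c] and [n - 1 >= 3] rim vertices.  Since
    [deg_G(c) deg_H(c) = n - 1], some rim vertex [u] is a [G]-neighbour of [c].
    Then [deg_H(u) = deg_H(c)] divides [deg_X(u) = 3].  Moreover every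
    [H]-neighbour of [c] is an [X]-neighbour of [u] on the rim, reached from [u]
    through [c], and [u] has only two rim neighbours.  Hence [deg_H(c) = 1]
    ([wheel_factor_hub_deg]).  Exchanging [G] and [H] gives [deg_G(c) = 1], so
    [n - 1 = 1], a contradiction. *)

Set Implicit Arguments.
Unset Strict Implicit.
Unset Printing Implicit Defensive.

(** * Factorizations on a common vertex set *)

Definition nbhd (V : finType) (G : sgraph V) (v : V) : {set V} :=
  [set w | adj G v w].

Definition deg (V : finType) (G : sgraph V) (v : V) : nat := #|nbhd G v|.

(** The [(i, j)] entry of [A(G) A(H)] counts the common elements of [N_G(i)] and
    [N_H(j)], so this is [A(G) A(H) = A(X)] without labelings. *)
Definition factorization (V : finType) (G H X : sgraph V) : Prop :=
  forall i j, #|nbhd G i :&: nbhd H j| = adj X i j.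

Definition pullback_rel (V U : finType) (f : V -> U) (G : sgraph U) : rel V :=
  fun x y => adj G (f x) (f y).

Lemma pullback_rel_sym (V U : finType) (f : V -> U) (G : sgraph U) :
  symmetric (pullback_rel f G).
Proof. by move=> x y; apply: adj_sym. Qed.

Lemma pullback_rel_irr (V U : finType) (f : V -> U) (G : sgraph U) :
  irreflexive (pullback_rel f G).
Proof. by move=> x; apply: adj_irr. Qed.

Definition pullback (V U : finType) (f : V -> U) (G : sgraph U) : sgraph V :=
  SGraph (@pullback_rel_sym V U f G) (@pullback_rel_irr V U f G).

(** The labelings identify the vertex sets of both factors with that of [X];
    transporting the factors along these bijections leaves [X] itself
    untouched. *)
Lemma MPF_factorization (V : finType) (X : sgraph V) :
  MPF X -> exists G H : sgraph V, factorization G H X.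
Proof.
move=> [U [W [G [H [lG [lH [lX eqX]]]]]]].
exists (pullback (vertex lG \o lX) G), (pullback (vertex lH \o lX) H) => i j.
have /matrixP/(_ (lX i) (lX j)) := eqX.
rewrite !mxE !labelK => eq_ij; apply/eqP.
rewrite -(Num.Theory.eqr_nat int) -eq_ij -sum1_card GRing.natr_sum.
rewrite big_mkcond (reindex (vertex lX)) /=; last first.
  by exists lX => k _; rewrite ?labelK ?vertexK.
apply/eqP/eq_bigr => k _; rewrite !mxE !inE /= /pullback_rel /= vertexK.
by rewrite [adj H _ (vertex lH k)]adj_sym; do 2!case: (adj _ _ _).
Qed.

Section Factorization.

Variables (V : finType) (G H X : sgraph V).
Hypothesis facX : factorization G H X.

Lemma factorization_adj i k j : adj G i k -> adj H k j -> adj X i j.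
Proof.
move=> Gik Hkj; have: 0 < #|nbhd G i :&: nbhd H j|.
  by apply/card_gt0P; exists k; rewrite !inE Gik adj_sym.
by rewrite facX; case: (adj X i j).
Qed.

Lemma factorization_walk i j : adj X i j -> exists2 k, adj G i k & adj H k j.
Proof.
move=> Xij; have /card_gt0P[k]: 0 < #|nbhd G i :&: nbhd H j| by rewrite facX Xij.
by rewrite !inE => /andP[Gik Hjk]; exists k; rewrite // adj_sym.
Qed.

Lemma factorization_walk_uniq i j k k' :
  adj G i k -> adj H k j -> adj G i k' -> adj H k' j -> k = k'.
Proof.
move=> Gik Hkj Gik' Hk'j.
have /card_le1_eqP: #|nbhd G i :&: nbhd H j| <= 1 by rewrite facX; case: adj.
by apply; rewrite !inE ?Gik ?Gik' adj_sym.
Qed.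

(** Transposing the symmetric matrix [A(X)] exchanges the two factors. *)
Lemma factorizationC : factorization H G X.
Proof. by move=> i j; rewrite setIC facX adj_sym. Qed.

(** Sliding along alternating squares: [w] in [N_H(v)] goes to the opposite
    vertex [z] of the square through [u], [v], [w]; and [w] is recovered as the
    midpoint of the walk from [z] to [v]. *)
Lemma deg_factor_edge_le u v : adj G v u -> deg H v <= deg H u.
Proof.
move=> Gvu.
have ex_z w : w \in nbhd H v -> exists z, adj G z w && adj H z u.
  rewrite inE => Hvw; have Guv : adj G u v by rewrite adj_sym.
  have := factorization_adj Guv Hvw; rewrite adj_sym => /factorization_walk[z].
  by move=> Gwz Hzu; exists z; rewrite adj_sym Gwz Hzu.
pose f w := odflt w [pick z | adj G z w && adj H z u].
have fP w : w \in nbhd H v -> adj G (f w) w && adj H (f w) u.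
  move=> /ex_z[z zP]; rewrite /f; case: pickP => [//|no_z].
  by rewrite no_z in zP.
rewrite /deg -(card_in_imset (f := f)).
  apply/subset_leq_card/subsetP => _ /imsetP[w /fP/andP[_ Hfu] ->].
  by rewrite inE adj_sym.
move=> w w' wP w'P eq_f.
have /andP[Gw _] := fP _ wP; have /andP[Gw' _] := fP _ w'P.
rewrite -eq_f in Gw'; rewrite !inE in wP w'P.
by apply: (factorization_walk_uniq (j := v) Gw _ Gw'); rewrite adj_sym.
Qed.

End Factorization.

Lemma deg_factor_edge (V : finType) (G H X : sgraph V) u v :
  factorization G H X -> adj G v u -> deg H u = deg H v.
Proof.
move=> facX Gvu; apply/eqP; rewrite eqn_leq.
by rewrite !(deg_factor_edge_le facX) // adj_sym.
Qed.

Lemma degE (V : finType) (G : sgraph V) v : deg G v = \sum_w adj G v w.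
Proof.
rewrite /deg /nbhd -sum1dep_card big_mkcond.
by apply: eq_bigr => w _; case: adj.
Qed.

(** Each [X]-neighbour of [v] is the end of one walk from [v], and there are
    [deg H u = deg H v] walks through each [u] in [N_G(v)]. *)
Lemma deg_factorization (V : finType) (G H X : sgraph V) v :
  factorization G H X -> deg X v = deg G v * deg H v.
Proof.
move=> facX; transitivity (\sum_j \sum_(k in nbhd G v) adj H k j).
  rewrite degE; apply: eq_bigr => j _.
  rewrite -facX -sum1_card big_mkcond [RHS]big_mkcond; apply: eq_bigr => k _.
  by rewrite !inE [adj H j k]adj_sym; do 2!case: (adj _ _ _).
rewrite exchange_big -sum_nat_const; apply: eq_bigr => k.
by rewrite inE => Gvk; rewrite -degE (deg_factor_edge facX Gvk).
Qed.

(** * Wheels *)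

Lemma deg_cycle (m : nat) (i : 'I_m) : 2 < m -> deg (cycle_graph m) i = 2.
Proof.
move=> m_gt2.
have vS (k : 'I_m) : ordS k = (if k.+1 == m then 0 else k.+1) :> nat.
  rewrite /=; case: eqP => [->|/eqP neq]; first by rewrite modnn.
  by rewrite modn_small // ltn_neqAle neq ltn_ord.
have neqS (k : 'I_m) : k != ordS k.
  by apply/eqP => /(congr1 (@nat_of_ord m)); rewrite vS; case: ifP; lia.
have neqSS (k : 'I_m) : ordS (ordS k) != k.
  apply/eqP => /(congr1 (@nat_of_ord m)); rewrite !vS.
  by have := ltn_ord k; do !case: ifP; lia.
have -> : deg (cycle_graph m) i = #|[set ordS i; ord_pred i]|.
  apply: eq_card => j; rewrite !inE /= /cycle_rel.
  rewrite -[j == ord_pred i](inj_eq (@ordS_inj m)) ord_predK.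
  rewrite [ordS j == i]eq_sym; case: (eqVneq i j) => [<-|//].
  by rewrite (negbTE (neqS i)).
rewrite cards2 -(inj_eq (@ordS_inj m)) ord_predK.
by rewrite (negbTE (neqSS i)).
Qed.

Lemma deg_cone_apex (V : finType) (G : sgraph V) : deg (cone G) None = #|V|.
Proof.
rewrite -(card_imset predT (f := Some)); last exact: Some_inj.
apply: eq_card => -[v|].
  by rewrite inE /= imset_f.
by rewrite inE /=; apply/esym/imsetP => -[].
Qed.

Lemma nbhd_cone_base (V : finType) (G : sgraph V) v :
  nbhd (cone G) (Some v) = None |: [set Some w | w in nbhd G v].
Proof.
apply/setP => -[w|]; rewrite !inE //=.
by rewrite mem_imset ?inE //; apply: Some_inj.
Qed.

Lemma deg_cone_base (V : finType) (G : sgraph V) v :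
  deg (cone G) (Some v) = (deg G v).+1.
Proof.
rewrite /deg nbhd_cone_base cardsU1 card_imset; last exact: Some_inj.
by rewrite (_ : _ \notin _) //; apply/imsetP => -[].
Qed.

(** At a rim vertex [G]-adjacent to the hub, the degree identity shows that the
    [H]-degree of the hub divides 3, and the two rim neighbours bound it by 2. *)
Lemma wheel_factor_hub_deg (m : nat) (G H : sgraph (option 'I_m)) :
  2 < m -> factorization G H (cone (cycle_graph m)) -> deg H None = 1.
Proof.
move=> m_gt2 facX.
have := deg_factorization None facX; rewrite deg_cone_apex card_ord => hub.
have /card_gt0P[[i|]] : 0 < deg G None.
  by rewrite lt0n; apply/eqP => G0; move: m_gt2; rewrite hub G0.
  rewrite inE => Gci; have Gic : adj G (Some i) None by rewrite adj_sym.
  have := deg_factorization (Some i) facX.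
  rewrite deg_cone_base deg_cycle // (deg_factor_edge facX Gci) => deg3.
  have : deg H None <= 2.
    rewrite -(deg_cycle i m_gt2) {2}/deg.
    rewrite -(card_imset (f := Some)); last exact: Some_inj.
    apply/subset_leq_card/subsetP => -[j|]; rewrite inE ?adj_irr // => Hcj.
    rewrite mem_imset ?inE; last exact: Some_inj.
    exact: (factorization_adj facX Gic Hcj).
  by case: (deg H None) deg3 => [|[|[|]]] //; lia.
by rewrite inE adj_irr.
Qed.

Theorem theorem3p12 (n : nat) (hn : (4 <= n)%N) : ~ MPF (wheel n).
Proof.
have m_gt2 : 2 < n.-1 by lia.
move=> /MPF_factorization[G [H facX]].
have := deg_factorization None facX.
rewrite deg_cone_apex card_ord (wheel_factor_hub_deg m_gt2 facX).
rewrite (wheel_factor_hub_deg m_gt2 (factorizationC facX)); lia.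
Qed.
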